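(* In the star graph probing problem under the constant hazard rate patience model (defined in the context), an optimal probing strategy (one maximizing expected reward) exists and can be computed in time polynomial in $m$.
   Context: Star graph probing problem with constant hazard rates: there is a single online vertex $v$ and offline vertices $u_1,\dots,u_m$; vertex $u_i$ has weight $w_i\ge 0$, success probability $p_i\in[0,1]$, and hazard rate $r_i\in[0,1]$. A strategy adaptively probes offline vertices, each at most once. Probing $u_i$ succeeds independently with probability $p_i$, in which case $v$ is matched to $u_i$, reward $w_i$ is collected, and the process stops. If the probe of $u_i$ fails, then independently with probability $r_i$ the online vertex runs out of patience and the process stops with no further reward, and with probability $1-r_i$ another probe may be attempted. (When all $r_i$ equal a common $r$, this is a patience distribution with constant hazard rate $r$.) *)

(* Defs.v *)
From HB Require Import structures.
From mathcomp Require Import all_boot all_order all_algebra.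

Set Implicit Arguments.
Unset Strict Implicit.
Unset Printing Implicit Defensive.

Import Order.TTheory GRing.Theory Num.Theory.
Local Open Scope ring_scope.

(** * Probing on a star graph *)

Record instance (R : realFieldType) (m : nat) := Instance {
  weight : 'I_m -> R;
  success : 'I_m -> R;
  hazard : 'I_m -> R;
  weight_ge0 : forall i, 0 <= weight i;
  success_prob : forall i, 0 <= success i <= 1;
  hazard_prob : forall i, 0 <= hazard i <= 1
}.

(* An adaptive strategy chooses, from the sequence of vertices probed so far,
   the next vertex to probe, or [None] to give up.  While the process is still
   running all past probes have failed and left some patience, so that this
   sequence is everything that has been observed. *)
Definition strategy (m : nat) := seq 'I_m -> option 'I_m.

Definition admissible (m : nat) (sigma : strategy m) : Prop :=
  forall h i, sigma h = Some i -> i \notin h.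

(* [(omega i).1]: a probe of vertex i succeeds;
   [(omega i).2]: patience runs out if a probe of vertex i fails. *)
Definition outcome (m : nat) := {ffun 'I_m -> bool * bool}.

Definition bernoulli (R : realFieldType) (p : R) (b : bool) : R :=
  if b then p else 1 - p.

(* All success and patience bits are mutually independent. *)
Definition outcome_prob (R : realFieldType) (m : nat) (I : instance R m)
    (omega : outcome m) : R :=
  \prod_(i < m) (bernoulli (success I i) (omega i).1
                 * bernoulli (hazard I i) (omega i).2).

(* The process after the history [h], for at most [n] further probes. *)
Fixpoint reward_from (R : realFieldType) (m : nat) (I : instance R m)
    (sigma : strategy m) (omega : outcome m) (n : nat) (h : seq 'I_m) : R :=
  if n is n'.+1 then
    if sigma h is Some i then
      if (omega i).1 then weight I i
      else if (omega i).2 then 0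
      else reward_from I sigma omega n' (rcons h i)
    else 0
  else 0.

(* The bound [m] on the number of probes is no restriction for an admissible
   strategy, which never probes a vertex twice. *)
Definition reward (R : realFieldType) (m : nat) (I : instance R m)
    (sigma : strategy m) (omega : outcome m) : R :=
  reward_from I sigma omega m [::].

Definition expected_reward (R : realFieldType) (m : nat) (I : instance R m)
    (sigma : strategy m) : R :=
  \sum_(omega : outcome m) outcome_prob I omega * reward I sigma omega.

Definition optimal (R : realFieldType) (m : nat) (I : instance R m)
    (sigma : strategy m) : Prop :=
  admissible sigma /\
  forall sigma' : strategy m, admissible sigma' ->
    expected_reward I sigma' <= expected_reward I sigma.

(* The strategy that probes the entries of [s] in order.  As the process
   continues after only one of the possible results of a probe, every
   deterministic strategy behaves like one of these, so that a sequence of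
   vertices is a compact description of a strategy. *)
Definition list_strategy (m : nat) (s : seq 'I_m) : strategy m :=
  fun h => if prefix h s then onth s (size h) else None.

(** * Real RAM programs *)

(* Programs of a random access machine with natural number registers (counters
   and addresses), real number registers, and an unbounded indirectly
   addressed memory of each of the two kinds.  An elementary operation or test
   takes one unit of time.  There is no rounding, and no real constant other
   than 0 and 1, so that a program does not depend on the field R. *)

Inductive instr :=
| NConst (a k : nat)
| NAdd (a b c : nat)
| NSub (a b c : nat)
| NLoad (a b : nat)
| NStore (a b : nat)
| RZero (a : nat)
| ROne (a : nat)
| RAdd (a b c : nat)
| RSub (a b c : nat)
| RMul (a b c : nat)
| RDiv (a b c : nat)
| RLoad (a b : nat)
| RStore (a b : nat).

Inductive test :=
| NLt (a b : nat)
| RLe (a b : nat).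

Inductive prog :=
| Skip
| Do (i : instr)
| Seq (c1 c2 : prog)
| If (b : test) (c1 c2 : prog)
| While (b : test) (c : prog).

Record state (R : realFieldType) := State {
  nreg : nat -> nat;
  rreg : nat -> R;
  nmem : nat -> nat;
  rmem : nat -> R
}.

Definition set_nreg (R : realFieldType) (st : state R) (a v : nat) : state R :=
  State [eta nreg st with a |-> v] (rreg st) (nmem st) (rmem st).
Definition set_rreg (R : realFieldType) (st : state R) (a : nat) (x : R) :
    state R :=
  State (nreg st) [eta rreg st with a |-> x] (nmem st) (rmem st).
Definition set_nmem (R : realFieldType) (st : state R) (a v : nat) : state R :=
  State (nreg st) (rreg st) [eta nmem st with a |-> v] (rmem st).
Definition set_rmem (R : realFieldType) (st : state R) (a : nat) (x : R) :
    state R :=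
  State (nreg st) (rreg st) (nmem st) [eta rmem st with a |-> x].

(* [None] is a run-time error; the only one is a division by zero.
   Subtraction of natural numbers is truncated. *)
Definition run_instr (R : realFieldType) (i : instr) (st : state R) :
    option (state R) :=
  match i with
  | NConst a k => Some (set_nreg st a k)
  | NAdd a b c => Some (set_nreg st a (nreg st b + nreg st c)%N)
  | NSub a b c => Some (set_nreg st a (nreg st b - nreg st c)%N)
  | NLoad a b => Some (set_nreg st a (nmem st (nreg st b)))
  | NStore a b => Some (set_nmem st (nreg st a) (nreg st b))
  | RZero a => Some (set_rreg st a 0)
  | ROne a => Some (set_rreg st a 1)
  | RAdd a b c => Some (set_rreg st a (rreg st b + rreg st c))
  | RSub a b c => Some (set_rreg st a (rreg st b - rreg st c))
  | RMul a b c => Some (set_rreg st a (rreg st b * rreg st c))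
  | RDiv a b c =>
      if rreg st c == 0 then None
      else Some (set_rreg st a (rreg st b / rreg st c))
  | RLoad a b => Some (set_rreg st a (rmem st (nreg st b)))
  | RStore a b => Some (set_rmem st (nreg st a) (rreg st b))
  end.

Definition run_test (R : realFieldType) (b : test) (st : state R) : bool :=
  match b with
  | NLt x y => (nreg st x < nreg st y)%N
  | RLe x y => rreg st x <= rreg st y
  end.

(* [exec c st t st']: started in state [st], the program [c] halts in state
   [st'] after [t] units of time. *)
Inductive exec (R : realFieldType) :
    prog -> state R -> nat -> state R -> Prop :=
| exec_skip st : exec Skip st 1%N st
| exec_do i st st' : run_instr i st = Some st' -> exec (Do i) st 1%N st'
| exec_seq c1 c2 st t1 st1 t2 st2 :
    exec c1 st t1 st1 -> exec c2 st1 t2 st2 ->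
    exec (Seq c1 c2) st (t1 + t2)%N st2
| exec_if_true b c1 c2 st t st' :
    run_test b st -> exec c1 st t st' -> exec (If b c1 c2) st t.+1 st'
| exec_if_false b c1 c2 st t st' :
    ~~ run_test b st -> exec c2 st t st' -> exec (If b c1 c2) st t.+1 st'
| exec_while_true b c st t1 st1 t2 st2 :
    run_test b st -> exec c st t1 st1 -> exec (While b c) st1 t2 st2 ->
    exec (While b c) st (t1 + t2).+1 st2
| exec_while_false b c st :
    ~~ run_test b st -> exec (While b c) st 1%N st.

(* The input: m in register 0, and the weights, success probabilities and
   hazard rates one after the other in the first 3m cells of the real
   memory. *)
Definition input (R : realFieldType) (m : nat) (I : instance R m) : state R :=
  State (fun a => if a == 0%N then m else 0%N) (fun=> 0) (fun=> 0%N)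
    (nth 0 (codom (weight I) ++ codom (success I) ++ codom (hazard I))).

(* The output: the length of [s] in register 0, and its entries in the first
   cells of the natural number memory. *)
Definition outputs (R : realFieldType) (m : nat) (st : state R)
    (s : seq 'I_m) : Prop :=
  map val s = mkseq (nmem st) (nreg st 0%N).

(* Main.v *)
Require Import Defs.
From HB Require Import structures.
From mathcomp Require Import all_boot all_order all_algebra.
From mathcomp Require Import ring lra zify.

Set Implicit Arguments.
Unset Strict Implicit.
Unset Printing Implicit Defensive.

Import Order.TTheory GRing.Theory Num.Theory.
Local Open Scope ring_scope.

(* A probe of vertex i followed by a continuation of value v is worth
   w_i p_i + b_i v with b_i = (1 - p_i) (1 - r_i), a convex combination of v and
   of the score k_i = w_i p_i / (1 - b_i).  Exchanging two adjacent probes i, j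
   therefore changes the value by a nonnegative multiple of k_j - k_i, so that
   moving any first probe back to its place in the order by decreasing score does
   not decrease the value; by induction on the number of probes, probing all
   vertices in this order is at least as good as any adaptive strategy.  The order
   is computed in quadratic time by counting, for every vertex, the vertices that
   precede it. *)

(** * Expectation over independent bits and the value of one probe *)

Section Expectation.

Variables (R : realFieldType) (m : nat) (I : instance R m).
Implicit Types (i j : 'I_m) (omega : outcome m) (F : outcome m -> R).

Definition expect F : R := \sum_omega outcome_prob I omega * F omega.

Definition bits_prob i (x : bool * bool) : R :=
  bernoulli (success I i) x.1 * bernoulli (hazard I i) x.2.

Definition resample i (x : bool * bool) omega : outcome m :=
  [ffun j => if j == i then x else omega j].

Lemma eq_expect F G : F =1 G -> expect F = expect G.
Proof. by move=> FG; apply: eq_bigr => omega _; rewrite FG. Qed.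

Lemma sum_bits (G : bool * bool -> R) :
  \sum_x G x =
  G (true, true) + G (true, false) + (G (false, true) + G (false, false)).
Proof.
rewrite (eq_bigr (fun x => G (x.1, x.2))); last by case.
by rewrite -(pair_bigA _ (fun a b => G (a, b))) /= !big_bool.
Qed.

Lemma sum_bits_prob i : \sum_x bits_prob i x = 1.
Proof. by rewrite sum_bits /bits_prob /bernoulli /=; ring. Qed.

Lemma expect_cst (c : R) : expect (fun=> c) = c.
Proof.
rewrite /expect -mulr_suml -(bigA_distr_bigA bits_prob) big1 ?mul1r // => i _.
exact: sum_bits_prob.
Qed.

(* Exchanging the bits of vertex i with a fresh independent copy preserves the
   joint law. *)
Lemma expect_resample i F :
  expect F = \sum_x bits_prob i x * expect (F \o resample i x).
Proof.
pose Q omega := \prod_(j | j != i) bits_prob j (omega j).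
have probE omega : outcome_prob I omega = bits_prob i (omega i) * Q omega.
  by rewrite /outcome_prob (bigD1 i).
have Q_resample x omega : Q (resample i x omega) = Q omega.
  by apply: eq_bigr => j /negPf ji; rewrite ffunE ji.
pose swap (y : (bool * bool) * outcome m) := (y.2 i, resample i y.1 y.2).
have swapK : involutive swap.
  case=> x omega; rewrite /swap /= ffunE eqxx; congr pair.
  by apply/ffunP => j; rewrite !ffunE; case: eqP => [->|].
(* A fresh copy [x] of total mass 1 is added; the weights of the resulting double sum are invariant
   under [swap]. *)
transitivity
  (\sum_x \sum_omega bits_prob i x * (outcome_prob I omega * F omega)).
  rewrite exchange_big; apply: eq_bigr => omega _.
  by rewrite -mulr_suml sum_bits_prob mul1r.
under [RHS]eq_bigr => x _ do rewrite /expect mulr_sumr.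
rewrite !pair_bigA (reindex_inj (inv_inj swapK)) /=.
apply: eq_bigr => -[x omega] _ /=.
by rewrite !probE Q_resample ffunE eqxx; ring.
Qed.

Definition survival i : R := (1 - success I i) * (1 - hazard I i).

Definition probe_value i (v : R) : R :=
  weight I i * success I i + survival i * v.

(** After resampling, the branch taken depends on the fresh bits of i alone, and [F] ignores them,
    so the expectation splits over their four values. *)
Lemma expect_probe i F :
    (forall x omega, F (resample i x omega) = F omega) ->
  expect (fun omega => if (omega i).1 then weight I i
                       else if (omega i).2 then 0 else F omega) =
  probe_value i (expect F).
Proof.
move=> FE; rewrite (expect_resample i) sum_bits.
under eq_expect => omega do rewrite /= ffunE eqxx /=.
under [expect (_ \o resample i (true, false))]eq_expect
  => omega do rewrite /= ffunE eqxx /=.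
under [expect (_ \o resample i (false, true))]eq_expect
  => omega do rewrite /= ffunE eqxx /=.
under [expect (_ \o resample i (false, false))]eq_expect
  => omega do rewrite /= ffunE eqxx /= FE.
by rewrite !expect_cst /bits_prob /bernoulli /probe_value /survival /=; ring.
Qed.

(** An admissible strategy never again reads the bits of a vertex in [h]. This is the independence
    that [expect_probe] asks for. *)
Lemma reward_from_agree (sigma : strategy m) n h omega omega' :
    admissible sigma -> (forall j, j \notin h -> omega j = omega' j) ->
  reward_from I sigma omega n h = reward_from I sigma omega' n h.
Proof.
move=> adm; elim: n h => //= n IHn h eq_omega.
case sigma_h: (sigma h) => [i|//].
rewrite (eq_omega _ (adm _ _ sigma_h)) (IHn (rcons h i)) // => j.
by rewrite mem_rcons inE negb_or => /andP[_ /eq_omega].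
Qed.

Lemma expect_reward_from (sigma : strategy m) n h i :
    admissible sigma -> sigma h = Some i ->
  expect (fun omega => reward_from I sigma omega n.+1 h) =
  probe_value i (expect (fun omega => reward_from I sigma omega n (rcons h i))).
Proof.
move=> adm sigma_h /=; rewrite sigma_h expect_probe // => x omega.
apply: reward_from_agree => // j; rewrite mem_rcons inE negb_or => /andP[ji _].
by rewrite ffunE (negPf ji).
Qed.

Definition list_value (s : seq 'I_m) : R := foldr probe_value 0 s.

Lemma list_strategy_admissible (s : seq 'I_m) :
  uniq s -> admissible (list_strategy s).
Proof.
move=> s_uniq h i; rewrite /list_strategy; case: prefixP => // -[t s_eq].
move: s_uniq; rewrite s_eq onth_cat ltnn subnn.
case: t {s_eq} => //= j t; rewrite cat_uniq /= negb_or.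
by move=> /and3P[_ /andP[jh _] _] [<-].
Qed.

(** Splitting the list lets the induction go through: each probe moves the head of [t] to the end of
    [h]. *)
Lemma expect_list_strategy n (h t : seq 'I_m) :
    uniq (h ++ t) -> (size t <= n)%N ->
  expect (fun omega => reward_from I (list_strategy (h ++ t)) omega n h) =
  list_value t.
Proof.
elim: n h t => [|n IHn] h t ht_uniq.
  by case: t ht_uniq => // _ _; apply: expect_cst.
case: t ht_uniq => [|i t] ht_uniq t_n.
  rewrite -[RHS]expect_cst; apply: eq_expect => omega /=.
  by rewrite /list_strategy cats0 prefix_refl onth_default.
rewrite (@expect_reward_from _ _ _ i); last 2 first.
- exact: list_strategy_admissible.
- by rewrite /list_strategy prefix_prefix onth_cat ltnn subnn.
by rewrite -cat_rcons IHn // cat_rcons.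
Qed.

End Expectation.

(** * Exchange argument for the order by decreasing score *)

Section Optimality.

Variables (R : realFieldType) (m : nat) (I : instance R m).
Implicit Types (i j : 'I_m) (s : seq 'I_m).

(* The limit of the expected reward when infinitely many copies of vertex i are
   probed. *)
Definition score i : R :=
  if 1 - survival I i <= 0 then 0
  else weight I i * success I i / (1 - survival I i).

Lemma survival_bounds i : 0 <= survival I i <= 1.
Proof.
have := success_prob I i; have := hazard_prob I i; rewrite /survival.
by move=> /andP[r0 r1] /andP[p0 p1]; apply/andP; split; nra.
Qed.

(* If the survival probability is 1 then the success probability is 0, so that
   the junk score 0 is harmless. *)
Lemma probe_valueE i v :
  probe_value I i v = score i * (1 - survival I i) + survival I i * v.
Proof.
congr (_ + _); rewrite /score; case: ifPn => [b1|]; last first.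
  by rewrite -ltNge => b1; rewrite divfK // gt_eqF.
have := success_prob I i; have := hazard_prob I i; move: b1; rewrite /survival.
move=> b1 /andP[r0 r1] /andP[p0 p1]; rewrite mul0r.
suff -> : success I i = 0 by rewrite mulr0.
by nra.
Qed.

Lemma ler_probe_value i : {homo probe_value I i : u v / u <= v}.
Proof.
move=> u v uv; rewrite lerD2l ler_wpM2l //.
by have /andP[] := survival_bounds i.
Qed.

Lemma probe_value_exchange i j v : score i <= score j ->
  probe_value I i (probe_value I j v) <= probe_value I j (probe_value I i v).
Proof.
move=> ij; rewrite -subr_ge0 !probe_valueE.
have /andP[_ bi] := survival_bounds i; have /andP[_ bj] := survival_bounds j.
(* The terms in [v] cancel: both orders multiply [v] by the same two survival probabilities. *)
rewrite (_ : _ - _ = (score j - score i) *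
  ((1 - survival I i) * (1 - survival I j))); last by ring.
by rewrite !mulr_ge0 ?subr_ge0.
Qed.

Lemma list_value_ge0 s : 0 <= list_value I s.
Proof.
elim: s => //= i s IHs; rewrite addr_ge0 // mulr_ge0 ?weight_ge0 //.
  by have /andP[] := success_prob I i.
by have /andP[] := survival_bounds i.
Qed.

Definition by_score : rel 'I_m := fun i j => score j <= score i.

Lemma by_score_trans : transitive by_score.
Proof. by move=> j i k ij jk; apply: le_trans jk ij. Qed.

(** Adjacent exchanges carry i from the front back to its place; as [s] is sorted, each vertex it
    passes has at least its score. *)
Lemma probe_value_rem i s : sorted by_score s -> i \in s ->
  probe_value I i (list_value I (rem i s)) <= list_value I s.
Proof.
elim: s => //= j s IHs j_s; rewrite inE; case: eqVneq => [<-//|ij /= i_s].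
apply: le_trans (ler_probe_value _ (IHs (path_sorted j_s) i_s)).
apply: probe_value_exchange.
by have /allP/(_ _ i_s) := order_path_min by_score_trans j_s.
Qed.

(** After a first probe i, induction bounds the continuation by the sorted list without i, and
    [probe_value_rem] reinserts i. Giving up earns 0, and list values are nonnegative. *)
Lemma expect_reward_from_le (sigma : strategy m) n h s :
    admissible sigma -> sorted by_score s -> uniq s ->
    (forall i, i \notin h -> i \in s) ->
  expect I (fun omega => reward_from I sigma omega n h) <= list_value I s.
Proof.
move=> adm; elim: n h s => [|n IHn] h s s_sorted s_uniq hs.
  by rewrite expect_cst list_value_ge0.
case sigma_h: (sigma h) => [i|]; last first.
  under eq_expect => omega do rewrite /= sigma_h.
  by rewrite expect_cst list_value_ge0.
rewrite (expect_reward_from _ _ adm sigma_h).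
have i_s : i \in s by apply: hs; apply: adm sigma_h.
apply: le_trans (probe_value_rem s_sorted i_s); apply: ler_probe_value.
apply: IHn; rewrite ?rem_uniq //.
  by apply: subseq_sorted s_sorted; [exact: by_score_trans | exact: rem_subseq].
move=> j; rewrite mem_rcons inE negb_or => /andP[ji /hs js].
by rewrite mem_rem_uniq // inE ji.
Qed.

Lemma list_strategy_optimal s :
  sorted by_score s -> perm_eq s (enum 'I_m) -> optimal I (list_strategy s).
Proof.
move=> s_sorted s_perm.
have s_uniq : uniq s by rewrite (perm_uniq s_perm) enum_uniq.
split=> [|sigma adm]; first exact: list_strategy_admissible.
have -> : expected_reward I (list_strategy s) = list_value I s.
  apply: (@expect_list_strategy _ _ I m [::] s) => //.
  by rewrite (perm_size s_perm) size_enum_ord.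
apply: expect_reward_from_le => // i _.
by rewrite (perm_mem s_perm) mem_enum.
Qed.

End Optimality.

(** * Total correctness with time bounds *)

Section Runs.

Variable R : realFieldType.
Implicit Types (st : state R) (c : prog) (Q : state R -> Prop).

(** [T] is only an upper bound, so that branches of different cost can share one budget. *)
Definition runs c st T Q :=
  exists t st', [/\ exec c st t st', (t <= T)%N & Q st'].

Lemma runs_weaken T c st T' Q Q' :
    (T <= T')%N -> (forall st', Q st' -> Q' st') ->
  runs c st T Q -> runs c st T' Q'.
Proof.
move=> TT' QQ' [t [st' [ex tT /QQ' Qst']]].
by exists t, st'; split=> //; apply: leq_trans TT'.
Qed.

Lemma runs_skip st Q : Q st -> runs Skip st 1 Q.
Proof. by move=> Qst; exists 1%N, st; split=> //; apply: exec_skip. Qed.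

Lemma runs_do i st st' Q : run_instr i st = Some st' -> Q st' ->
  runs (Do i) st 1 Q.
Proof. by move=> run Qst'; exists 1%N, st'; split=> //; apply: exec_do. Qed.

Lemma runs_seq Q1 c1 c2 st T1 T2 Q :
    runs c1 st T1 Q1 -> (forall st1, Q1 st1 -> runs c2 st1 T2 Q) ->
  runs (Seq c1 c2) st (T1 + T2)%N Q.
Proof.
move=> [t1 [st1 [ex1 tT1 /[swap] run2 /run2[t2 [st2 [ex2 tT2 Qst2]]]]]].
exists (t1 + t2)%N, st2; split=> //; last exact: leq_add.
exact: exec_seq ex1 ex2.
Qed.

Lemma runs_do_seq i c st st' T Q :
    run_instr i st = Some st' -> runs c st' T Q ->
  runs (Seq (Do i) c) st T.+1 Q.
Proof.
move=> run runc; rewrite -add1n; apply: (runs_seq (Q1 := eq st')).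
  exact: runs_do run _.
by move=> _ <-.
Qed.

Lemma runs_if b c1 c2 st T Q :
    (run_test b st -> runs c1 st T Q) -> (~~ run_test b st -> runs c2 st T Q) ->
  runs (If b c1 c2) st T.+1 Q.
Proof.
move=> run1 run2; case: (boolP (run_test b st)) => tb.
  have [t [st' [ex tT Qst']]] := run1 tb.
  by exists t.+1, st'; split=> //; apply: exec_if_true.
have [t [st' [ex tT Qst']]] := run2 tb.
by exists t.+1, st'; split=> //; apply: exec_if_false.
Qed.

(** The index of [Inv] counts completed iterations; the successors in the bound pay for n successful
    tests and a last failing one. *)
Lemma runs_while (Inv : nat -> state R -> Prop) b c T n st :
    (forall k st', Inv k st' -> run_test b st' = (k < n)%N) ->
    (forall k st', (k < n)%N -> Inv k st' -> runs c st' T (Inv k.+1)) ->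
  Inv 0%N st -> runs (While b c) st (n * T.+1).+1 (Inv n).
Proof.
move=> testE body.
have loop d k st' : (k + d)%N = n -> Inv k st' ->
    runs (While b c) st' (d * T.+1).+1 (Inv n).
  elim: d k st' => [|d IHd] k st' kn Inv_k.
    exists 1%N, st'; split=> //; last by rewrite -kn addn0.
    by apply: exec_while_false; rewrite (testE _ _ Inv_k) -kn addn0 ltnn.
  have k_n : (k < n)%N by rewrite -kn addnS ltnS leq_addr.
  have [t1 [st1 [ex1 tT1 Inv1]]] := body _ _ k_n Inv_k.
  have [|t2 [st2 [ex2 tT2 Inv2]]] := IHd k.+1 st1 _ Inv1.
    by rewrite addSn -addnS.
  exists (t1 + t2).+1, st2; split=> //; last first.
    by rewrite ltnS mulSn; lia.
  by apply: exec_while_true ex1 ex2; rewrite (testE _ _ Inv_k).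
exact: loop.
Qed.

End Runs.

(** * The sorting program *)

(* Ties between scores are broken by the number of the vertex, which makes the
   positions distinct.
   Counters: 0 holds m, 1 holds 1, 2 and 3 hold vertices i and j, 4 holds the
   position of i.  Reals: 4 and 5 hold the scores of i and j. *)

Definition score_prog (x d : nat) : prog :=
  Seq (Do (RLoad 1 x))
  (Seq (Do (NAdd 5 x 0))
  (Seq (Do (RLoad 2 5))
  (Seq (Do (NAdd 5 5 0))
  (Seq (Do (RLoad 3 5))
  (Seq (Do (ROne 0))
  (Seq (Do (RMul 1 1 2))
  (Seq (Do (RSub 2 0 2))
  (Seq (Do (RSub 3 0 3))
  (Seq (Do (RMul 2 2 3))
  (Seq (Do (RSub 2 0 2))
  (Seq (Do (RZero d))
  (If (RLe 2 d) Skip (Do (RDiv d 1 2)))))))))))))).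

(** Two opposite [RLe] tests detect equal scores, in which case the numbers decide whether j
    precedes i. *)
Definition count_prog : prog :=
  Seq (score_prog 3 5)
  (Seq (If (RLe 5 4)
         (If (RLe 4 5) (If (NLt 3 2) (Do (NAdd 4 4 1)) Skip) Skip)
         (Do (NAdd 4 4 1)))
  (Do (NAdd 3 3 1))).

Definition place_prog : prog :=
  Seq (score_prog 2 4)
  (Seq (Do (NConst 3 0))
  (Seq (Do (NConst 4 0))
  (Seq (While (NLt 3 0) count_prog)
  (Seq (Do (NStore 4 2))
  (Do (NAdd 2 2 1)))))).

Definition sort_prog : prog :=
  Seq (Do (NConst 1 1)) (While (NLt 2 0) place_prog).

(** * Correctness and running time of the program *)

Section Ranking.

Variables (R : realFieldType) (m : nat) (f : nat -> R).
Implicit Types (st : state R).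

(** The score in terms of raw memory cells, so that loop invariants mention neither ordinals nor an
    instance. *)
Definition cell_score (x : nat) : R :=
  let d := 1 - (1 - f (x + m)%N) * (1 - f (x + m + m)%N) in
  if d <= 0 then 0 else f x * f (x + m)%N / d.

Definition cell_le : rel nat := fun x y =>
  (cell_score y <= cell_score x) &&
  ((cell_score x <= cell_score y) ==> (x <= y)%N).

(** The bound n makes this the counter's value midway through the inner loop; at n = m it is the
    final position of x. *)
Definition rank n x := count (fun y => ~~ cell_le x y) (iota 0 n).

(** Registers 0 to 3 are scratch, whence [3 < d]. The last two clauses are frame conditions: the
    score of i survives the computation of that of j. *)
Lemma score_prog_runs x d st :
    (3 < d)%N -> nreg st 0%N = m -> rmem st = f ->
  runs (score_prog x d) st 14 (fun st' =>
    [/\ nmem st' = nmem st, rmem st' = f, rreg st' d = cell_score (nreg st x),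
        (forall a, a != 5 -> nreg st' a = nreg st a)
      & (forall a, (3 < a)%N -> a != d -> rreg st' a = rreg st a)]).
Proof.
move=> d3 st0 stf.
do 12!apply: runs_do_seq => //.
have d0 : (0 == d) = false by lia.
have d1 : (1 == d) = false by lia.
have d2 : (2 == d) = false by lia.
have reals a : (3 < a)%N -> a != d ->
  [/\ (a == d) = false, (a == 0) = false, (a == 1) = false, (a == 2) = false
    & (a == 3) = false].
  by move=> a3 /negPf ad; split=> //; lia.
apply: runs_if => [|/negPf]; rewrite /= ?eqxx ?d0 ?d1 ?d2 /= st0 stf => test_d.
  apply: runs_skip; split=> //= [|a /negPf a5|a a3 ad].
  - by rewrite eqxx /cell_score test_d.
  - by rewrite a5.
  - by have [-> -> -> -> ->] := reals a a3 ad.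
apply: runs_do.
  rewrite /= ?d0 ?d1 ?d2 /= ifF //.
  (* The failed test excludes a zero divisor, hence a run-time error. *)
  by apply: contraFF test_d => /eqP ->.
split=> //= [|a /negPf a5|a a3 ad].
- by rewrite eqxx /cell_score test_d.
- by rewrite a5.
- by have [-> -> -> -> ->] := reals a a3 ad.
Qed.

Definition counting (M : nat -> nat) i n st :=
  [/\ nmem st = M, rmem st = f, rreg st 4%N = cell_score i
    & [/\ nreg st 0%N = m, nreg st 1%N = 1%N, nreg st 2%N = i,
          nreg st 3%N = n & nreg st 4%N = rank n i]].

Lemma rankS n x : rank n.+1 x = (rank n x + ~~ cell_le x n)%N.
Proof. by rewrite /rank -addn1 iotaD count_cat /= addn0. Qed.

Lemma count_prog_runs M i n st :
  counting M i n st -> runs count_prog st 19 (counting M i n.+1).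
Proof.
case=> stM stf st_i [st0 st1 st2 st3 st4].
apply: (runs_seq (T1 := 14) (T2 := 5)); first exact: score_prog_runs.
move=> {}st' [stM' stf' st_n' nregs rregs].
have {nregs} nregE a : (a < 5)%N -> nreg st' a = nreg st a.
  by move=> a5; apply: nregs; lia.
have {rregs}st_i' : rreg st' 4%N = cell_score i by rewrite rregs.
rewrite st3 in st_n'.
(* Intermediate state: the count already includes vertex n, but register 3 has not advanced yet. *)
pose Q := fun st'' : state R =>
  [/\ nmem st'' = M, rmem st'' = f, rreg st'' 4%N = cell_score i
    & [/\ nreg st'' 0%N = m, nreg st'' 1%N = 1%N, nreg st'' 2%N = i,
          nreg st'' 3%N = n & nreg st'' 4%N = rank n.+1 i]].
apply: (runs_seq (T1 := 4) (T2 := 1) (Q1 := Q)); last first.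
  move=> st'' [? ? ? [? ? ? st3'' ?]]; apply: runs_do; first by [].
  by split=> //; split=> //=; rewrite st3''; lia.
have stay : ~~ ~~ cell_le i n -> Q st'.
  move=> /negPf le_in; split=> //; first by rewrite stM'.
  by rewrite rankS le_in addn0 !nregE.
have incr : ~~ cell_le i n -> runs (Do (NAdd 4 4 1)) st' 1 Q.
  move=> le_in; apply: runs_do; first by [].
  split=> //=; first by rewrite stM'.
  by rewrite rankS le_in !nregE // st4 st1.
apply: runs_if => /=; rewrite st_i' st_n' => ni.
  apply: runs_if => /=; rewrite st_i' st_n' => le_in.
    apply: runs_if => /=; rewrite !nregE // st2 st3 => lt_ni.
      by apply: incr; rewrite /cell_le ni le_in /= -ltnNge.
    by apply/runs_skip/stay; rewrite negbK /cell_le ni le_in /= leqNgt.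
  apply: (@runs_weaken _ 1 _ _ _ Q) => //; apply/runs_skip/stay.
  by rewrite negbK /cell_le ni (negPf le_in).
apply: (@runs_weaken _ 1 _ _ _ Q) => //; apply: incr.
by rewrite /cell_le (negPf ni).
Qed.

Definition placing n st :=
  [/\ rmem st = f, nreg st 0%N = m, nreg st 1%N = 1%N, nreg st 2%N = n
    & forall i, (i < n)%N -> nmem st (rank m i) = i].

(** Distinct ranks ensure that storing vertex n overwrites no vertex placed earlier. *)
Lemma place_prog_runs n st :
    (forall i, (i < n)%N -> rank m i != rank m n) ->
  placing n st -> runs place_prog st (m * 20 + 19)%N (placing n.+1).
Proof.
move=> rank_n [stf st0 st1 st2 st_rank].
apply: (@runs_weaken _ (14 + (m * 20 + 3).+2) _ _ _ (placing n.+1)) => //.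
  by lia.
apply: runs_seq; first exact: score_prog_runs.
move=> st' [stM' stf' st_n' nregs rregs].
do 2![apply: runs_do_seq; first by []].
apply: (@runs_weaken _ ((m * 20).+1 + 2) _ _ _ (placing n.+1)) => //.
  by lia.
apply: (runs_seq (Q1 := counting (nmem st) n m)).
  apply: runs_while.
  - by move=> k st'' [_ _ _ [st0'' _ _ st3'' _]] /=; rewrite st0'' st3''.
  - by move=> k st'' _; apply: count_prog_runs.
  - by split=> //=; rewrite ?st_n' ?st2 // !nregs.
move=> st'' [stM'' ? ? [? st1'' st2'' _ st4'']].
apply: runs_do_seq; first by [].
apply: runs_do; first by [].
split=> //=; first by rewrite st2'' st1'' addn1.
move=> i; rewrite ltnS leq_eqVlt st4'' st2'' stM'' => /predU1P[->|i_n].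
  by rewrite eqxx.
by rewrite (negPf (rank_n i i_n)) st_rank.
Qed.

Lemma sort_prog_runs st :
    {in gtn m &, injective (rank m)} -> nreg st 0%N = m -> nreg st 2%N = 0%N ->
    rmem st = f ->
  runs sort_prog st (m * (m * 20 + 20)).+2 (placing m).
Proof.
move=> rank_inj st0 st2 stf; apply: runs_do_seq; first by [].
apply: (@runs_weaken _ (m * (m * 20 + 19).+1).+1 _ _ _ (placing m)) => //.
  by lia.
apply: runs_while => //.
  by move=> k st' [_ st0' _ st2' _] /=; rewrite st0' st2'.
move=> k st' k_m; apply: place_prog_runs => i i_k.
apply/eqP => eq_rank; have i_m : (i < m)%N := ltn_trans i_k k_m.
by rewrite (rank_inj i k i_m k_m eq_rank) ltnn in i_k.
Qed.

End Ranking.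

(** * Ranks as positions in the sorted list of vertices *)

(** By antisymmetry the entries before x fail [leT x y]; x itself and all later entries satisfy
    it. *)
Lemma count_index (T : eqType) (leT : rel T) (s : seq T) x :
    reflexive leT -> transitive leT -> antisymmetric leT ->
    sorted leT s -> uniq s -> x \in s ->
  count (fun y => ~~ leT x y) s = index x s.
Proof.
move=> le_refl le_trans le_anti; elim: s => //= y s IHs y_s /andP[ys s_uniq].
have /allP le_y : all (leT y) s by apply: order_path_min y_s.
rewrite inE eq_sym; case: eqVneq => [<- _|yx /= x_s].
  rewrite le_refl add0n; apply/eqP; rewrite -leqn0 leqNgt -has_count.
  by apply/hasPn => z /le_y; rewrite negbK.
suff /negPf -> : ~~ leT x y by rewrite IHs // (path_sorted y_s).
by apply: contra yx => xy; apply/eqP/le_anti; rewrite xy le_y.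
Qed.

Section Output.

Variables (R : realFieldType) (m : nat) (I : instance R m).
Let f := rmem (input I).
Let leI : rel 'I_m := relpre val (cell_le m f).

Lemma cell_score_input (i : 'I_m) : cell_score m f i = score I i.
Proof.
have nth_codom (g : 'I_m -> R) : nth 0 (codom g) i = g i.
  by rewrite codomE (nth_map i) ?size_enum_ord // nth_ord_enum.
have sz (g : 'I_m -> R) : size (codom g) = m by rewrite size_codom card_ord.
have fw : f i = weight I i by rewrite /f /= nth_cat sz ltn_ord nth_codom.
have fp : f (i + m)%N = success I i.
  by rewrite /f /= !nth_cat !sz ltnNge leq_addl addnK ltn_ord nth_codom.
have fr : f (i + m + m)%N = hazard I i.
  rewrite /f /= !nth_cat !sz ltnNge leq_addl addnK ltnNge leq_addl.
  by rewrite /= addnK nth_codom.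
by rewrite /cell_score fw fp fr.
Qed.

Lemma leI_refl : reflexive leI.
Proof. by move=> i; rewrite /leI /= /cell_le lexx leqnn. Qed.

Lemma leI_trans : transitive leI.
Proof.
move=> j i k; rewrite /leI /= /cell_le => /andP[ji ij] /andP[kj jk].
rewrite (le_trans kj ji); apply/implyP => ik.
have := implyP ij (le_trans ik kj); have := implyP jk (le_trans ji ik).
by move=> /[swap]; apply: leq_trans.
Qed.

Lemma leI_anti : antisymmetric leI.
Proof.
move=> i j; rewrite /leI /= /cell_le => /andP[].
move=> /andP[ji /implyP ij] /andP[ij' /implyP ji'].
by apply/val_inj/anti_leq; rewrite ij ?ji'.
Qed.

Lemma leI_total : total leI.
Proof.
move=> i j; rewrite /leI /= /cell_le.
by case: ltgtP => //= _; apply: leq_total.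
Qed.

Definition sorted_vertices : seq 'I_m := sort leI (enum 'I_m).

Lemma sorted_vertices_uniq : uniq sorted_vertices.
Proof. by rewrite sort_uniq enum_uniq. Qed.

Lemma mem_sorted_vertices i : i \in sorted_vertices.
Proof. by rewrite mem_sort mem_enum. Qed.

(** Counting is invariant under permutation, so it may be done along the sorted list, where
    [count_index] applies. *)
Lemma rank_index (i : 'I_m) : rank m f m i = index i sorted_vertices.
Proof.
rewrite /rank -val_enum_ord count_map.
rewrite -(count_index leI_refl leI_trans leI_anti) ?mem_sorted_vertices //.
- by apply/permP; rewrite perm_sym; apply/permPl/perm_sort.
- by apply: sort_sorted; apply: leI_total.
- exact: sorted_vertices_uniq.
Qed.

Lemma sorted_vertices_optimal : optimal I (list_strategy sorted_vertices).
Proof.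
apply: list_strategy_optimal; last exact/permPl/perm_sort.
apply: sub_sorted (sort_sorted leI_total _) => i j /andP[ij _].
by rewrite /by_score -!cell_score_input.
Qed.

Lemma sort_prog_correct :
  runs sort_prog (input I) (m * (m * 20 + 20)).+2
    (fun st => outputs st sorted_vertices).
Proof.
apply: runs_weaken (sort_prog_runs (m := m) (f := f) _ _ _ _) => //; last first.
  move=> i j i_m j_m; rewrite -[i]/(val (Ordinal i_m)) -[j]/(val (Ordinal j_m)).
  rewrite !rank_index => /(congr1 (nth (Ordinal i_m) sorted_vertices)).
  by rewrite !nth_index ?mem_sorted_vertices // => ->.
move=> st [_ st0 _ _ st_rank].
have sz : size sorted_vertices = m by rewrite size_sort size_enum_ord.
apply: (@eq_from_nth _ 0%N); first by rewrite size_map size_mkseq st0.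
move=> k; rewrite size_map sz => k_m; rewrite nth_mkseq ?st0 //.
(* Cell k was filled by the k-th sorted vertex, since that vertex has rank k. *)
pose i := nth (Ordinal k_m) sorted_vertices k.
have rank_i : rank m f m i = k.
  by rewrite rank_index index_uniq ?sz ?sorted_vertices_uniq.
by rewrite (nth_map (Ordinal k_m)) ?sz // -/i -[in RHS]rank_i st_rank.
Qed.

End Output.

Theorem theorem2 (R : realFieldType) :
  (forall (m : nat) (I : instance R m),
     exists sigma : strategy m, optimal I sigma) /\
  (exists (c : prog) (q : {poly nat}),
     forall (m : nat) (I : instance R m),
       exists (t : nat) (st : state R) (s : seq 'I_m),
         [/\ exec c (input I) t st, (t <= q.[m])%N, outputs st s
           & optimal I (list_strategy s)]).
Proof.
split=> [m I|].
  by exists (list_strategy (sorted_vertices I)); apply: sorted_vertices_optimal.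
(* Coefficients by increasing degree: 2 + 20 m + 20 m^2 is the bound of [sort_prog_correct]. *)
exists sort_prog, (Poly [:: 2; 20; 20]) => m I.
have [t [st [ex t_le out]]] := sort_prog_correct I.
exists t, st, (sorted_vertices I); split=> //;
  last exact: sorted_vertices_optimal.
apply: leq_trans t_le _; by rewrite horner_Poly /=; lia.
Qed.
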